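(* For every integer $n\ge 1$, the number of Nyldon words of length $n$ over $A$ equals the number of Lyndon words of length $n$ over $A$.
   Context: $A$ is a finite alphabet of cardinality at least $2$ with a total order $<$. $A^*$ is the set of finite words over $A$ (including the empty word $\varepsilon$), $|w|$ is the length of $w$. The lexicographic order $<_{\mathrm{lex}}$ on $A^*$ is the total order given by: $u<_{\mathrm{lex}}v$ if $u$ is a proper prefix of $v$, or there exist letters $i<j$ and a word $p$ such that $pi$ is a prefix of $u$ and $pj$ is a prefix of $v$; $u\le_{\mathrm{lex}}v$ means $u<_{\mathrm{lex}}v$ or $u=v$. Nyldon words are defined recursively on length: every letter (word of length $1$) is Nyldon; a word $w$ of length at least $2$ is Nyldon if and only if there is no sequence $(n_1,\ldots,n_k)$ of Nyldon words with $w=n_1\cdots n_k$, $\max\{|n_1|,\ldots,|n_k|\}<|w|$ and $n_1\le_{\mathrm{lex}}\cdots\le_{\mathrm{lex}}n_k$. The empty word is not Nyldon. Two words $x,y$ are conjugate if $x=uv$ and $y=vu$ for some words $u,v$. A word is primitive if it is not of the form $u^k$ with $u\in A^*$ and $k\ge 2$ (so $\varepsilon$ is not primitive). A word is Lyndon if it is primitive and lexicographically minimal among its conjugates. *)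

(* Defs.v *)
From mathcomp Require Import all_boot all_order boolp.

Set Implicit Arguments.
Unset Strict Implicit.
Unset Printing Implicit Defensive.

Import Order.TTheory.

Section Words.
Context {d : Order.disp_t} {A : finOrderType d}.
Implicit Types (u v w x y : seq A) (ns : seq (seq A)).

Definition lexle : rel (seq A) := fun u v => (u <= v :> seqlexi A)%O.

Lemma lexleP u v :
  lexle u v <->
  [\/ u = v,
      exists2 s, s <> [::] & v = u ++ s
    | exists i j p s t, [/\ (i < j)%O, u = p ++ i :: s & v = p ++ j :: t]].
Proof.
rewrite /lexle; split.
- elim: u v => [|a u IH] [|b v] //.
  + by move=> _; apply: Or31.
  + by move=> _; apply: Or32; exists (b :: v).
  rewrite leEseqlexi; case: (ltgtP a b) => //= [ab _|<- /IH].
    by apply: Or33; exists a, b, [::], u, v.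
  case=> [->|[s s0 ->]|[i [j [p [s [t [ij -> ->]]]]]]].
  + by apply: Or31.
  + by apply: Or32; exists s.
  + by apply: Or33; exists i, j, (a :: p), s, t.
- case=> [->//|[s _ ->]|[i [j [p [s [t [ij -> ->]]]]]]].
    by elim: u => [|a u IH] //; rewrite cat_cons leEseqlexi lexx.
  elim: p => [|a p IH]; last by rewrite !cat_cons leEseqlexi lexx.
  by rewrite !cat0s leEseqlexi (ltW ij) leNgt ij.
Qed.

(* Recursion on a bound [k] for the length: only words of length at most [k]
   can satisfy [nyldon_upto k].  [nyldonE] is the intended recursive
   characterization. *)
Fixpoint nyldon_upto (k : nat) (w : seq A) : Prop :=
  if k is k'.+1 then
    size w = 1 \/
    [/\ 2 <= size w <= k &
        ~ exists ns : seq (seq A),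
            [/\ w = flatten ns,
                forall x, x \in ns -> nyldon_upto k' x,
                \max_(x <- ns) size x < size w
              & sorted lexle ns]]
  else False.

Definition nyldon (w : seq A) : Prop := nyldon_upto (size w) w.

Lemma nyldon_upto_mono k w : size w <= k -> nyldon_upto k w <-> nyldon w.
Proof.
have H : forall k m w, size w <= k -> size w <= m ->
    nyldon_upto k w <-> nyldon_upto m w.
  elim=> [|k0 IH] [|m] x //=.
  - rewrite leqn0 => /eqP sx _; rewrite sx.
    by split=> // -[//|[]].
  - move=> _; rewrite leqn0 => /eqP sx; rewrite sx.
    by split=> // -[//|[]].
  move=> xk xm.
  have E ns : \max_(z <- ns) size z < size x ->
      (forall z, z \in ns -> nyldon_upto k0 z) <->
      (forall z, z \in ns -> nyldon_upto m z).
    move=> lt; split=> h z zns; have := h z zns; have zx : size z < size x.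
    + exact: leq_ltn_trans (leq_bigmax_seq (F := size) z zns isT) lt.
    + by move=> hz; apply/(IH m z) => //; rewrite -ltnS;
        [apply: leq_trans zx xk | apply: leq_trans zx xm].
    + exact: leq_ltn_trans (leq_bigmax_seq (F := size) z zns isT) lt.
    + by move=> hz; apply/(IH m z) => //; rewrite -ltnS;
        [apply: leq_trans zx xk | apply: leq_trans zx xm].
  split=> -[->|[/andP[x2 _] nex]]; [by left|right|by left|right];
    split; rewrite ?x2 ?xk ?xm //; move=> [ns [xE hn lt so]];
    by apply: nex; exists ns; split=> //; apply/(E ns).
by move=> wk; apply: H.
Qed.

Lemma nyldonE w :
  nyldon w <->
  size w = 1 \/
  2 <= size w /\
  ~ exists ns : seq (seq A),
      [/\ w = flatten ns,
          forall x, x \in ns -> nyldon x,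
          \max_(x <- ns) size x < size w
        & sorted lexle ns].
Proof.
rewrite /nyldon; case sw: (size w) => [|k] /=.
  by split=> // -[//|[]].
have E ns : \max_(z <- ns) size z < size w ->
    (forall z, z \in ns -> nyldon_upto k z) <->
    (forall z, z \in ns -> nyldon z).
  move=> lt; split=> h z zns; apply/(nyldon_upto_mono (k := k)); try exact: h;
  rewrite -ltnS -sw;
  exact: leq_ltn_trans (leq_bigmax_seq (F := size) z zns isT) lt.
rewrite sw leqnn andbT.
split=> -[->|[k2 nex]]; [by left|right|by left|right];
  split=> // -[ns [wE hn lt so]]; apply: nex; exists ns; split=> //;
  by apply/E; rewrite ?sw.
Qed.

Definition conjugate (x y : seq A) : Prop :=
  exists u v : seq A, x = u ++ v /\ y = v ++ u.

Definition primitive (w : seq A) : Prop :=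
  ~ exists (u : seq A) (k : nat), 2 <= k /\ w = flatten (nseq k u).

Definition lyndon (w : seq A) : Prop :=
  primitive w /\ forall y : seq A, conjugate w y -> lexle w y.

End Words.

(* Main.v *)
Require Import Defs.
From mathcomp Require Import all_boot all_order boolp.

Set Implicit Arguments.
Unset Strict Implicit.
Unset Printing Implicit Defensive.

Import Order.TTheory.

(** Both families of words factor the free monoid: every word is, in exactly
    one way, a lexicographically nondecreasing product of Nyldon words, and in
    exactly one way a nonincreasing product of Lyndon words
    ([factorizing_nyldon], [factorizing_lyndon]).  Such a unique sorted
    factorization identifies words with multisets of factors, so the number of
    factors of each length is forced by the number of words: a word of length
    [n] that is not itself a factor is a multiset of strictly shorter factors,
    and once the two families agree in lengths below [n] there are as many of
    these multisets for one family as for the other ([factorizing_count]).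

    Uniqueness comes in both cases from recognizing the last factor inside the
    word.  In a Nyldon factorization it is the longest Nyldon suffix
    ([last_factor_longest]), which rests on the fact that a Nyldon word
    dominates all its Nyldon suffixes ([nyldon_suffix_le]).  In a Lyndon
    factorization it is the least nonempty suffix ([last_factor_min]), which
    rests on the description of Lyndon words as the nonempty words strictly
    smaller than all their proper nonempty suffixes ([lyndonbP]). *)

(** * Sorted factorizations *)

Section Factorization.
Variable A : eqType.
Implicit Types (P : pred (seq A)) (r : rel (seq A)) (w : seq A).

Definition factorization P r w (s : seq (seq A)) : bool :=
  [&& all P s, sorted r s & flatten s == w].

Definition factorizing P r : Prop :=
  forall w, exists! s, factorization P r w s.

(** A member as long as the whole concatenation leaves only empty words for
    the other members. *)
Lemma flatten_full (s : seq (seq A)) x :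
  [::] \notin s -> x \in s -> size (flatten s) <= size x -> s = [:: x].
Proof.
move=> nil_s xs; case/splitPr: xs nil_s => s1 s2.
rewrite mem_cat inE !negb_or flatten_cat /= !size_cat.
move=> /and3P[nil1 _ nil2]; rewrite addnCA -[leqRHS]addn0 leq_add2l leqn0.
have nilE (t : seq (seq A)) : [::] \notin t -> size (flatten t) = 0 -> t = [::].
  by case: t => [|[|a y] t] //=; rewrite inE.
by rewrite addn_eq0 => /andP[/eqP/nilE-> // /eqP/nilE->].
Qed.

(** A nonempty suffix of a product starts inside one of the factors, [y], of
    which it takes the nonempty end [p]. *)
Lemma flatten_suffix (l : seq (seq A)) u v :
    flatten l = u ++ v -> v != [::] ->
  exists l1 y l2 q p,
    [/\ l = l1 ++ y :: l2, y = q ++ p, p != [::] & v = p ++ flatten l2].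
Proof.
elim: l u => [|z l IH] u /=.
  by move/esym/nilP; rewrite /nilp size_cat addn_eq0 => /andP[_ /nilP->].
move=> E v0; have [le|lt] := leqP (size z) (size u).
  have [u' uE] : exists u', u = z ++ u'.
    exists (drop (size z) u); rewrite -{1}(cat_take_drop (size z) u).
    congr (_ ++ _); move/(congr1 (take (size z))): E.
    by rewrite take_size_cat // takel_cat.
  move: E; rewrite uE -catA => /eqP; rewrite eqseq_cat // eqxx /= => /eqP.
  move=> /IH/(_ v0)[l1 [y [l2 [q [p [-> yE p0 vE]]]]]].
  by exists (z :: l1), y, l2, q, p.
exists [::], z, l, (take (size u) z), (drop (size u) z); split=> //.
- by rewrite cat_take_drop.
- by rewrite -size_eq0 size_drop subn_eq0 -ltnNge.
have := congr1 (drop (size u)) E.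
by rewrite [RHS]drop_size_cat // drop_cat lt => <-.
Qed.

Lemma cat_inj_suffix (u v x y : seq A) :
  size x = size y -> u ++ x = v ++ y -> u = v /\ x = y.
Proof.
move=> xy E; have uv : size u = size v.
  by apply: (@addIn (size x)); rewrite {2}xy -!size_cat E.
by move/eqP: E; rewrite eqseq_cat // => /andP[/eqP-> /eqP->].
Qed.

Lemma factorization_nil P r w s :
  P [::] = false -> factorization P r w s -> (s == [::]) = (w == [::]).
Proof.
move=> P0 /and3P[Ps _ /eqP <-]; case: s Ps => [|[|a x] s] //=.
by rewrite P0.
Qed.

Lemma factorization_rcons P r u x s :
  factorization P r (u ++ x) (rcons s x) -> factorization P r u s.
Proof.
case/and3P; rewrite all_rcons flatten_rcons => /andP[_ Ps] so /eqP E.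
have [sE _] := cat_inj_suffix erefl E; rewrite /factorization Ps sE eqxx andbT.
by move: so; rewrite -cats1 => /cat_sorted2[].
Qed.

(** If the last factor is determined by the word, cancelling it and repeating
    determines the whole factorization. *)
Lemma factorizing_of_last P r :
    P [::] = false ->
    (forall w, exists s, factorization P r w s) ->
    (forall w s x t y, factorization P r w (rcons s x) ->
       factorization P r w (rcons t y) -> x = y) ->
  factorizing P r.
Proof.
move=> P0 ex last_uniq w; have [s sw] := ex w; exists s; split=> // t.
elim/last_ind: s w sw t => [|s x IH] w sw t tw.
  move: (factorization_nil P0 sw) (factorization_nil P0 tw) => <-.
  by move=> /eqP.
case/lastP: t tw => [|t y] tw.
  move: (factorization_nil P0 sw) (factorization_nil P0 tw) => <-.
  by case: (s).
have xy := last_uniq _ _ _ _ _ sw tw; rewrite -{y}xy in tw *.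
have wE : w = flatten s ++ x.
  by case/and3P: sw => _ _ /eqP <-; rewrite flatten_rcons.
rewrite wE in sw tw; congr rcons.
exact: IH (factorization_rcons sw) _ (factorization_rcons tw).
Qed.

End Factorization.

(** * Counting the factors of a given length *)

Section Counting.
Variable A : finType.
Implicit Types (P Q : pred (seq A)) (r q : rel (seq A)) (w : seq A).

Definition words P n : seq (seq A) :=
  [seq tval t | t <- enum [pred t : n.-tuple A | P t]].

Lemma mem_words P n w : (w \in words P n) = (size w == n) && P w.
Proof.
apply/mapP/andP => [[t]|[sz Pw]].
  by rewrite mem_enum inE => Pt ->; rewrite size_tuple.
by exists (Tuple sz) => //; rewrite mem_enum inE.
Qed.

Lemma uniq_words P n : uniq (words P n).
Proof. by rewrite map_inj_uniq ?enum_uniq //; apply: val_inj. Qed.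

Lemma size_words P n : size (words P n) = #|[pred t : n.-tuple A | P t]|.
Proof. by rewrite size_map -cardE. Qed.

(** The bijection between the words of [P] and of [Q] of each given length that
    matches their enumerations; it is meaningful only for lengths where the two
    families are equinumerous. *)
Definition transfer P Q w : seq A :=
  nth [::] (words Q (size w)) (index w (words P (size w))).

Section Transfer.
Variables (P Q : pred (seq A)) (n : nat).
Hypothesis PQ : forall m, m < n -> size (words P m) = size (words Q m).

Lemma transferP w : P w -> size w < n ->
  [/\ Q (transfer P Q w), size (transfer P Q w) = size w
    & transfer Q P (transfer P Q w) = w].
Proof.
move=> Pw wn; have wP : w \in words P (size w) by rewrite mem_words eqxx.
have lt : index w (words P (size w)) < size (words Q (size w)).
  by rewrite -PQ // index_mem.
have := mem_nth [::] lt; rewrite mem_words -/(transfer P Q w) => /andP[/eqP sz QT].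
by split=> //; rewrite {1}/transfer sz index_uniq ?uniq_words ?nth_index.
Qed.
End Transfer.

(** If [P] and [Q] agree in lengths below [n], a word of length [n] outside [P]
    is sent to a word outside [Q]: transfer its factors, which are all shorter,
    and multiply them in the order required by [q].  Unique factorization
    in [Q] gives the transferred multiset back, and sorting by [r] then restores
    the original factorization, so the map is injective.  Hence [Q] has at least
    as many non-members of length [n] as [P] does. *)
Lemma count_le P r Q q n :
    total r -> transitive r -> antisymmetric r -> total q ->
    factorizing P r -> factorizing Q q ->
    (forall m, m < n -> size (words P m) = size (words Q m)) ->
  size (words Q n) <= size (words P n).
Proof.
move=> r_tot r_tr r_anti q_tot facP facQ PQ.
have P0 : P [::] = false.
  apply/negP => P0; have [s [_ u]] := facP [::].
  have E : s = [::] by apply: u.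
  by have := u [:: [::]]; rewrite E /factorization /= P0 => /(_ isT).
have /choice[fP fPE] : forall w, exists s, factorization P r w s.
  by move=> w; have [s []] := facP w; exists s.
pose F w := flatten (sort q (map (transfer P Q) (fP w))).
have small w : w \in words (predC P) n ->
    {in fP w, forall x, P x /\ size x < n}.
  rewrite mem_words /= => /andP[/eqP sz nPw] x xs.
  case/and3P: (fPE w) => /allP aP _ /eqP fE; split; first exact: aP.
  rewrite ltnNge -sz; apply/negP => le.
  have E : fP w = [:: x].
    apply: flatten_full xs _; last by rewrite fE.
    by apply/negP => /aP; rewrite P0.
  by move: fE (aP _ xs) nPw; rewrite E /= cats0 => -> ->.
have FE w : w \in words (predC P) n ->
  [/\ F w \in words (predC Q) n
    & factorization Q q (F w) (sort q (map (transfer P Q) (fP w)))].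
  move=> wn; set s := fP w; set t := map _ s.
  have [so fE] : sorted r s /\ flatten s = w.
    by case/and3P: (fPE w) => _ so /eqP.
  have perm_t : perm_eq (sort q t) t by rewrite perm_sort.
  have Fs x : x \in sort q t -> Q x /\ size x < n.
    rewrite mem_sort => /mapP[y /(small w wn)[Py yn] ->].
    by have [? -> _] := transferP PQ Py yn.
  have facF : factorization Q q (F w) (sort q t).
    rewrite /factorization sort_sorted // eqxx !andbT.
    by apply/allP => x /Fs[].
  split=> //; rewrite mem_words /=; have szF : size (F w) = n.
    rewrite (perm_size (perm_flatten perm_t)) size_flatten /shape -map_comp.
    have -> : map (size \o transfer P Q) s = map size s.
      apply/eq_in_map => x /(small w wn)[Px xn] /=.
      by have [_ ->] := transferP PQ Px xn.
    rewrite -/(shape s) -size_flatten fE.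
    by move: wn; rewrite mem_words => /andP[/eqP].
  rewrite szF eqxx /=; apply/negP => QF.
  (* If F w were in Q, it would be its own only factor, of length n. *)
  have [s' [_ u]] := facQ (F w).
  have E : sort q t = [:: F w].
    rewrite -(u _ facF); apply: u.
    by rewrite /factorization /= QF cats0 eqxx.
  by have [_] := Fs (F w) ltac:(by rewrite E mem_head); rewrite szF ltnn.
have F_inj : {in words (predC P) n &, injective F}.
  have GF w : w \in words (predC P) n ->
      flatten (sort r (map (transfer Q P)
        (sort q (map (transfer P Q) (fP w))))) = w.
    move=> wn; case/and3P: (fPE w) => _ so /eqP fE; rewrite -[RHS]fE.
    congr flatten; rewrite -[RHS](sorted_sort r_tr so).
    apply/perm_sortP => //; rewrite -[X in perm_eq _ X]map_id.
    rewrite (perm_trans (perm_map _ (permEl (perm_sort _ _)))) // -map_comp.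
    suff /eq_in_map-> : {in fP w, transfer Q P \o transfer P Q =1 id} by [].
    move=> x /(small w wn)[Px xn] /=.
    by have [_ _ ->] := transferP PQ Px xn.
  move=> w1 w2 w1n w2n E; rewrite -(GF _ w1n) -(GF _ w2n).
  have [[_ fac1] [_ fac2]] := (FE _ w1n, FE _ w2n); rewrite -E in fac2.
  have [s [_ u]] := facQ (F w1).
  by rewrite -(u _ fac1) -(u _ fac2).
have: size (words (predC P) n) <= size (words (predC Q) n).
  rewrite -(size_map F); apply: uniq_leq_size.
    by rewrite map_inj_in_uniq ?uniq_words.
  by move=> _ /mapP[w /FE[? _] ->].
rewrite !size_words.
have := cardC [pred t : n.-tuple A | P t].
rewrite -(cardC [pred t : n.-tuple A | Q t]) => E.
by rewrite -(leq_add2l #|[pred t : n.-tuple A | P t]|) E leq_add2r.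
Qed.

Theorem factorizing_count P r Q q n :
    total r -> transitive r -> antisymmetric r ->
    total q -> transitive q -> antisymmetric q ->
    factorizing P r -> factorizing Q q ->
  size (words P n) = size (words Q n).
Proof.
move=> r1 r2 r3 q1 q2 q3 facP facQ.
elim/ltn_ind: n => n IH; apply/eqP; rewrite eqn_leq.
rewrite (count_le r1 r2 r3 q1 facP facQ) // andbT.
by apply: (count_le q1 q2 q3 r1 facQ facP) => // m /IH.
Qed.

End Counting.

(** * The lexicographic order *)

Section Lexicographic.
Context {d : Order.disp_t} {A : finOrderType d}.
Implicit Types u v w x y : seq A.

Lemma lexle_refl : reflexive (@lexle d A).
Proof. by move=> u; apply: lexx. Qed.

Lemma lexle_trans : transitive (@lexle d A).
Proof. by move=> v u w; apply: le_trans. Qed.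

Lemma lexle_anti : antisymmetric (@lexle d A).
Proof. by move=> u v; apply: le_anti. Qed.

Lemma lexle_total : total (@lexle d A).
Proof. by move=> u v; apply: le_total. Qed.

Lemma lexleNge u v : ~~ lexle u v -> lexle v u.
Proof. by case/orP: (lexle_total u v) => -> //. Qed.

Lemma lexle_cat2l p u v : lexle (p ++ u) (p ++ v) = lexle u v.
Proof. by elim: p => //= a p IH; rewrite /lexle lexi_cons lexx. Qed.

Lemma lexle_prefix u x : lexle u (u ++ x).
Proof. by rewrite -{1}[u]cats0 lexle_cat2l. Qed.

(** When the smaller word is not a prefix of the larger one, they are separated
    by a letter, and appending words on the right does not affect the strict
    comparison. *)
Lemma lexle_ext u v x y :
  lexle u v -> ~~ prefix u v -> ~~ lexle (v ++ y) (u ++ x).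
Proof.
elim: u v => [|a u IH] [|b v] //=.
rewrite /lexle !lexi_cons; case: (ltgtP a b) => //= _.
exact: IH.
Qed.

Lemma lexle_take u v x y :
  size u = size v -> lexle (u ++ x) (v ++ y) -> lexle u v.
Proof.
move=> uv; apply: contraTT => nuv; apply: lexle_ext; first exact: lexleNge.
apply: contra nuv => /prefixP[z uE].
move: uv; rewrite uE size_cat -[RHS]addn0 => /addnI/size0nil->.
by rewrite cats0 lexle_refl.
Qed.

End Lexicographic.

(** * Unique factorization into Nyldon words *)

Section Nyldon.
Context {d : Order.disp_t} {A : finOrderType d}.
Implicit Types (w x y z : seq A) (s t : seq (seq A)).

Definition nyldonb : pred (seq A) := fun w => `[< nyldon w >].

Local Notation nyfact := (factorization nyldonb lexle).

Lemma nyldonb_nil : nyldonb [::] = false.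
Proof. by apply/asboolP => /nyldonE[|[]]. Qed.

Lemma nyldon_factor w s : nyldonb w -> nyfact w s -> s = [:: w].
Proof.
move=> /asboolP Nw ws; have /and3P[/allP Ns so /eqP wE] := ws.
have nil_s : [::] \notin s by apply/negP => /Ns; rewrite nyldonb_nil.
have [[x xs le]|nex] := pselect (exists2 x, x \in s & size w <= size x).
  have sE : s = [:: x] by apply: flatten_full xs _; rewrite ?wE.
  by move: wE; rewrite sE /= cats0 => ->.
have small x : x \in s -> size x < size w.
  by move=> xs; rewrite ltnNge; apply/negP => le; apply: nex; exists x.
case/nyldonE: Nw => [w1|[w2 []]].
  case: s wE {ws Ns so nex} nil_s small => [/= wE|x s _]; first by rewrite -wE in w1.
  rewrite inE => /norP[x0 _] /(_ x (mem_head _ _)).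
  by rewrite w1; case: x x0.
exists s; split=> // [x /Ns/asboolP //|].
rewrite big_seq; elim/big_ind: _ => [|x y xw yw|x /small //].
  exact: leq_trans w2.
by rewrite gtn_max xw.
Qed.

Lemma nyfact_exists w : exists s, nyfact w s.
Proof.
case: w => [|a w]; first by exists [::].
have [Nw|nNw] := boolP (nyldonb (a :: w)).
  by exists [:: a :: w]; rewrite /factorization /= Nw cats0 eqxx.
have [s [wE Ns _ so]] : exists ns : seq (seq A),
      [/\ a :: w = flatten ns, forall x, x \in ns -> nyldon x,
          \max_(x <- ns) size x < size (a :: w) & sorted lexle ns].
  apply: contrapT => nex; case/asboolP: nNw; apply/nyldonE.
  by case: w nex => [|b w] nex; [left|right].
exists s; rewrite /factorization so -wE eqxx !andbT.
by apply/allP => x /Ns Nx; apply/asboolP.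
Qed.

Definition suffix_le w : Prop :=
  nyldonb w -> forall x y, w = x ++ y -> nyldonb y -> lexle y w.

(** Suppose a Nyldon suffix [y] starts in a factor [z], taking its end [p], and
    runs over the factors [l2] up to the end of [w].  Factor [p]: its last
    factor [v] is a Nyldon suffix of [z], so [v] is at most [z], and the
    factorization of [p] followed by [l2] is again sorted.  As [y] is Nyldon,
    this product has a single factor, so [l2] is empty and [y] is inside the
    last factor of [w].  The domination property is assumed up to the length of
    [w] because it is proved in an induction that uses this lemma. *)
Lemma last_factor_longest w t x u y :
    (forall z, size z <= size w -> suffix_le z) ->
    nyfact w (rcons t x) -> w = u ++ y -> nyldonb y ->
  size y <= size x.
Proof.
move=> sle ws wE Ny; have /and3P[/allP Ns so /eqP flat] := ws.
have y0 : y != [::] by apply: contraTneq Ny => ->; rewrite nyldonb_nil.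
have [l1 [z [l2 [q [p [lE zE p0 yE]]]]]] := flatten_suffix (etrans flat wE) y0.
have Nz : nyldonb z by apply: Ns; rewrite lE mem_cat mem_head orbT.
have zw : size z <= size w.
  by rewrite -flat lE flatten_cat /= !size_cat addnCA leq_addr.
have [s ps] := nyfact_exists p.
have s0 : s != [::] by rewrite (factorization_nil nyldonb_nil ps).
case/lastP: s s0 ps => // s v _ /and3P[Nsv sos /eqP pE].
have Nv : nyldonb v by move: Nsv; rewrite all_rcons => /andP[].
have vz : lexle v z.
  apply: (sle z zw Nz (q ++ flatten s) v) => //.
  by rewrite zE -pE flatten_rcons catA.
have so2 : path lexle z l2 by move: so; rewrite lE => /cat_sorted2[].
have : nyfact y (rcons s v ++ l2).
  rewrite /factorization all_cat Nsv flatten_cat pE -yE eqxx andbT /=.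
  apply/andP; split.
    by apply/allP => a al2; apply: Ns; rewrite lE mem_cat inE al2 !orbT.
  have := path_le lexle_trans vz so2.
  case: (s) sos => [|b s'] //=.
  by rewrite cat_path => ->; rewrite last_rcons.
move=> /(nyldon_factor Ny) E.
have l20 : l2 = [::].
  case: (l2) E => // c l2' /(congr1 size).
  by rewrite size_cat size_rcons /= addSn addnS.
move: lE yE; rewrite l20 cats1 cats0 => /rcons_inj[_ ->] ->.
by rewrite zE size_cat leq_addl.
Qed.

(** Induction on [w], then on the prefix [u] in front of the suffix [y].  The
    last factor [z] of [u] is greater than [y], otherwise [w] would factor with
    [y] as its last factor.  If [u] is [z], then [y] is below a prefix of [w].
    Otherwise let [q] be the last factor of [z ++ y], which is shorter than [w].
    It is strictly longer than [y], for otherwise the factorization of [z ++ y]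
    would be [z; y], which is not sorted.  Now [y] is at most [q] by induction
    on the length of the word, and [q] is at most [w] by induction on the
    prefix. *)
Lemma nyldon_suffix_le w : suffix_le w.
Proof.
have [n] := ubnP (size w); elim: n w => // n IHn w; rewrite ltnS => wn Nw u.
have [m] := ubnP (size u); elim: m u => // m IHm u; rewrite ltnS => um y wE Ny.
have y0 : y != [::] by apply: contraTneq Ny => ->; rewrite nyldonb_nil.
have [s us] := nyfact_exists u.
case/lastP: s us => [|s z] us.
  have := factorization_nil nyldonb_nil us.
  by rewrite eqxx wE => /esym/eqP->; apply: lexle_refl.
have /and3P[Nsz sos /eqP uE] := us; rewrite flatten_rcons in uE.
have /andP[Nz Ns] : nyldonb z && all nyldonb s by rewrite -all_rcons.
have nzy : ~~ lexle z y.
  apply/negP => zy; have : nyfact w (rcons (rcons s z) y).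
    rewrite /factorization !all_rcons Ny Nz Ns !flatten_rcons uE -wE eqxx andbT.
    case: (s) sos => [|b s'] /=; first by rewrite zy.
    by move=> {}sos; rewrite rcons_path sos last_rcons zy.
  by move=> /(nyldon_factor Nw)/(congr1 size); rewrite !size_rcons.
have [f0|f0] := eqVneq (flatten s) [::].
  apply: lexle_trans (lexleNge nzy) _.
  by rewrite wE -uE f0 lexle_prefix.
have zyw : size (z ++ y) < size w.
  rewrite wE -uE -catA [ltnRHS]size_cat -[ltnLHS]add0n ltn_add2r lt0n.
  by rewrite size_eq0.
have IHzy x : size x <= size (z ++ y) -> suffix_le x.
  by move=> xzy; apply: IHn; apply: leq_ltn_trans xzy (leq_trans zyw wn).
have [t zyt] := nyfact_exists (z ++ y).
case/lastP: t zyt => [|t q] zyt.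
  have := factorization_nil nyldonb_nil zyt.
  by rewrite -[RHS]size_eq0 size_cat addn_eq0 !size_eq0 (negPf y0) andbF.
have yq : size y <= size q := last_factor_longest IHzy zyt erefl Ny.
have /and3P[Ntq sot /eqP zyE] := zyt; rewrite flatten_rcons in zyE.
have Nq : nyldonb q by move: Ntq; rewrite all_rcons => /andP[].
move: yq; rewrite leq_eqVlt => /orP[/eqP yq|yq].
  have [_ yqE] := cat_inj_suffix (esym yq) zyE.
  rewrite yqE in zyt.
  have tE := nyldon_factor Nz (factorization_rcons zyt).
  by case/and3P: zyt; rewrite tE /= => _ /andP[zy]; rewrite zy in nzy.
have qE : q = drop (size (flatten t)) z ++ y.
  have := congr1 (drop (size (flatten t))) zyE.
  rewrite drop_size_cat // drop_cat; case: ltnP => // le qE.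
  have := congr1 size qE; rewrite size_drop => qy.
  by move: yq; rewrite qy ltnNge leq_subr.
have wE' : w = (flatten s ++ flatten t) ++ q.
  by rewrite -catA zyE catA uE.
have yleq : lexle y q.
  apply: (IHzy q _ Nq _ _ qE Ny).
  by rewrite -zyE size_cat leq_addl.
apply: lexle_trans yleq _; apply: (IHm _ _ _ wE' Nq).
apply: leq_trans um; rewrite -(ltn_add2r (size q)) -size_cat -wE' wE size_cat.
by rewrite ltn_add2l.
Qed.

Theorem factorizing_nyldon : factorizing nyldonb lexle.
Proof.
apply: factorizing_of_last nyldonb_nil nyfact_exists _ => w s x t y.
move=> wsx wty.
have [[/and3P[Nx _ /eqP wx]] [/and3P[Ny _ /eqP wy]]] := (wsx, wty).
move: Nx Ny wx wy; rewrite !all_rcons !flatten_rcons.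
move=> /andP[Nx _] /andP[Ny _] wx wy.
have sle z : size z <= size w -> suffix_le z by move=> _; apply: nyldon_suffix_le.
have xy : size x = size y.
  apply/eqP; rewrite eqn_leq (last_factor_longest sle wty (esym wx) Nx).
  by rewrite (last_factor_longest sle wsx (esym wy) Ny).
by have [] := cat_inj_suffix xy (etrans wx (esym wy)).
Qed.

End Nyldon.

(** * Unique factorization into Lyndon words *)

Section Lyndon.
Context {d : Order.disp_t} {A : finOrderType d}.
Implicit Types (u v w x y : seq A) (s t : seq (seq A)).

Definition lyndonb : pred (seq A) := fun w => `[< lyndon w >].

Definition suffix_minimal w : Prop :=
  w != [::] /\
  forall u v, w = u ++ v -> u != [::] -> v != [::] -> ~~ lexle v w.

(** Euclid's algorithm on the lengths: the shorter of two commuting words is a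
    prefix of the longer one and commutes with the rest of it. *)
Lemma commute_powers u v :
  u ++ v = v ++ u ->
  exists z i j, u = flatten (nseq i z) /\ v = flatten (nseq j z).
Proof.
have [n] := ubnP (size u + size v); elim: n u v => // n IH u v.
rewrite ltnS => uvn E; wlog uv : u v uvn E / size u <= size v.
  move=> H; have [|/ltnW] := leqP (size u) (size v); first exact: H.
  rewrite addnC in uvn => /(H _ _ uvn (esym E))[z [i [j [? ?]]]].
  by exists z, j, i.
have [->|u0] := eqVneq u [::].
  by exists v, 0, 1; rewrite /= cats0.
have [v' vE] : exists v', v = u ++ v'.
  exists (drop (size u) v); rewrite -{1}(cat_take_drop (size u) v).
  congr (_ ++ _); move/(congr1 (take (size u))): E.
  by rewrite take_size_cat // takel_cat.
have E' : u ++ v' = v' ++ u.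
  move: E; rewrite vE -catA => /eqP; rewrite eqseq_cat // eqxx => /eqP.
  by [].
have lt : size u + size v' < n.
  apply: leq_trans uvn; rewrite vE size_cat ltn_add2l -[ltnLHS]add0n ltn_add2r.
  by rewrite lt0n size_eq0.
have [z [i [j [uE v'E]]]] := IH _ _ lt E'.
exists z, i, (i + j); split=> //.
by rewrite vE {1}uE v'E nseqD flatten_cat.
Qed.

Lemma primitive_commute u v :
  primitive (u ++ v) -> u ++ v = v ++ u -> u = [::] \/ v = [::].
Proof.
move=> prim /commute_powers[z [i [j [uE vE]]]].
case: i uE => [|i] uE; first by left.
case: j vE => [|j] vE; first by right.
case: prim; exists z, (i.+1 + j.+1); split; first by rewrite addSn addnS.
by rewrite nseqD flatten_cat uE vE.
Qed.

(** Let [v] be a proper suffix of [w = u ++ v] with [v] at most [w].  If [v] is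
    not a prefix of [w], the conjugate [v ++ u] is smaller than [w].  If
    [w = v ++ u'], comparing [w] with its conjugates [v ++ u] and [u' ++ v]
    gives [u' = u], so [u] and [v] commute and [w] is not primitive. *)
Lemma lyndon_suffix_minimal w : lyndon w -> suffix_minimal w.
Proof.
case=> prim wmin; split.
  apply/eqP => w0; apply: prim; exists [::], 2; split=> //.
move=> u v wE u0 v0; apply/negP => vw.
have [/prefixP[u' wE']|npre] := boolP (prefix v w); last first.
  have := lexle_ext u [::] vw npre; rewrite cats0 => /negP; apply.
  by apply: wmin; exists u, v.
have leu : lexle u' u.
  by rewrite -(lexle_cat2l v) -wE'; apply: wmin; exists u, v.
have sz : size u = size u'.
  by apply: (@addIn (size v)); rewrite [RHS]addnC -!size_cat -wE -wE'.
have leu' : lexle u u'.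
  apply: (@lexle_take _ _ _ _ v v) => //; rewrite -wE.
  by apply: wmin; exists v, u'.
have uu' : u = u' by apply: lexle_anti; rewrite leu leu'.
have uv : u ++ v = v ++ u by rewrite -wE [in RHS]uu' -wE'.
rewrite wE in prim.
by case: (primitive_commute prim uv) => /eqP; rewrite ?(negPf u0) ?(negPf v0).
Qed.

Lemma suffix_minimal_lyndon w : suffix_minimal w -> lyndon w.
Proof.
case=> w0 wmin; split.
  case=> z [[|[|k]] [// _ wE]].
  have z0 : z != [::].
    by apply: contraNneq w0 => z0; rewrite wE z0; elim: (k.+2).
  have zk : flatten (nseq k.+1 z) != [::].
    by case: (z) z0.
  have := wmin _ _ wE z0 zk.
  have -> : w = flatten (nseq k.+1 z) ++ z.
    have := flatten_cat (nseq k.+1 z) (nseq 1 z).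
    by rewrite -nseqD addn1 [X in _ ++ X]cats0 => <-.
  by rewrite lexle_prefix.
move=> y [u [v [wE ->]]].
have [u0|u0] := eqVneq u [::]; first by rewrite wE u0 cats0 lexle_refl.
have [v0|v0] := eqVneq v [::]; first by rewrite wE v0 cats0 lexle_refl.
by apply: lexle_trans (lexleNge (wmin u v wE u0 v0)) (lexle_prefix _ _).
Qed.

Lemma lyndonbP w : reflect (suffix_minimal w) (lyndonb w).
Proof.
apply: (iffP (asboolP _)); first exact: lyndon_suffix_minimal.
exact: suffix_minimal_lyndon.
Qed.

Definition lexge : rel (seq A) := fun u v => lexle v u.

Local Notation lynfact := (factorization lyndonb lexge).

Lemma lyndonb_nil : lyndonb [::] = false.
Proof. by apply/lyndonbP => -[]. Qed.

Lemma min_suffix_exists w : w != [::] ->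
  exists u v, [/\ w = u ++ v, v != [::]
    & forall u' v', w = u' ++ v' -> v' != [::] -> lexle v v'].
Proof.
elim: w => // a w IH _; have [->|w0] := eqVneq w [::].
  exists [::], [:: a]; split=> // -[|b u'] v' /=.
    by move=> ->; rewrite lexle_refl.
  by case=> _; case: u' => //= <-.
have [u [v [wE v0 vmin]]] := IH w0.
have [av|nav] := boolP (lexle (a :: w) v).
  exists [::], (a :: w); split=> // -[|b u'] v'.
    by move=> ->; rewrite lexle_refl.
  by case=> _ wE' v'0; apply: lexle_trans av _; apply: vmin wE' v'0.
exists (a :: u), v; split=> //; first by rewrite wE.
move=> [|b u'] v'; first by rewrite cat0s => <- _; apply: lexleNge.
by case=> _; apply: vmin.
Qed.

(** The least nonempty suffix [v] of [w] is Lyndon, and it can be appended to a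
    factorization of the rest: if the preceding factor [l] were smaller than
    [v], then [l ++ v] would be a suffix of [w] smaller than [v]; when [l] is a
    prefix of [v = l ++ v'], this is because [v] is smaller than its suffix
    [v']. *)
Lemma lynfact_exists w : exists s, lynfact w s.
Proof.
have [n] := ubnP (size w); elim: n w => // n IH w; rewrite ltnS => wn.
have [->|w0] := eqVneq w [::]; first by exists [::].
have [u [v [wE v0 vmin]]] := min_suffix_exists w0.
have Lv : suffix_minimal v.
  split=> // p q vE p0 q0; apply/negP => qv.
  have vq : lexle v q by apply: (vmin (u ++ p)) => //; rewrite wE vE catA.
  have /(congr1 size)/eqP : v = q by apply: lexle_anti; rewrite vq qv.
  by rewrite vE size_cat -[eqbRHS]add0n eqn_add2r size_eq0 (negPf p0).
have un : size u < n.
  apply: leq_trans wn; rewrite wE size_cat -[ltnLHS]addn0 ltn_add2l.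
  by rewrite lt0n size_eq0.
have [s /and3P[Ls so /eqP uE]] := IH u un; exists (rcons s v).
rewrite /factorization all_rcons Ls flatten_rcons uE -wE eqxx andbT.
apply/andP; split; first by apply/lyndonbP.
case/lastP: s Ls so uE => // s l Ls so uE.
have vl : lexge l v.
  apply/negPn/negP => /[dup] nvl /lexleNge lv.
  have vlv : lexle v (l ++ v).
    apply: (vmin (flatten s)).
      by rewrite catA -flatten_rcons uE.
    by rewrite -size_eq0 size_cat addn_eq0 !size_eq0 (negPf v0) andbF.
  have [/prefixP[v' vE]|npre] := boolP (prefix l v); last first.
    by have := lexle_ext v [::] lv npre; rewrite cats0 vlv.
  have l0 : l != [::].
    by move: Ls; rewrite all_rcons => /andP[/lyndonbP[]].
  have v'0 : v' != [::].
    by apply: contraNneq nvl => v'0; rewrite vE v'0 cats0; apply: lexle_refl.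
  case: Lv => _ /(_ l v' vE l0 v'0)/negP; apply.
  by rewrite -(lexle_cat2l l) -vE.
case: s so {uE Ls} => [|b s] /=; first by rewrite vl.
by move=> so; rewrite rcons_path so last_rcons vl.
Qed.

(** A nonempty suffix starts with a suffix [p] of some factor [y], which is at
    least [y] since [y] is Lyndon, and [y] is at least the last factor. *)
Lemma last_factor_min w t x u v :
  lynfact w (rcons t x) -> w = u ++ v -> v != [::] -> lexle x v.
Proof.
move=> /and3P[/allP Lt so /eqP flat] wE v0.
have [l1 [y [l2 [q [p [lE yE p0 vE]]]]]] := flatten_suffix (etrans flat wE) v0.
have /lyndonbP[_ Ly] : lyndonb y by apply: Lt; rewrite lE mem_cat mem_head orbT.
have yp : lexle y p.
  have [q0|q0] := eqVneq q [::]; first by rewrite yE q0 lexle_refl.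
  exact: lexleNge (Ly _ _ yE q0 p0).
have xy : lexle x y.
  have so2 : path lexge y l2 by move: so; rewrite lE => /cat_sorted2[].
  have ge_tr : transitive lexge by move=> b a c ab bc; apply: lexle_trans bc ab.
  have xE : x = last y l2.
    by rewrite -(last_rcons x t x) lE last_cat.
  case/lastP: l2 so2 xE {lE vE} => [_ ->|l2 c so2]; first exact: lexle_refl.
  rewrite last_rcons => ->.
  by have /allP := order_path_min ge_tr so2; apply; rewrite mem_rcons mem_head.
by rewrite vE; apply: lexle_trans xy (lexle_trans yp (lexle_prefix _ _)).
Qed.

Theorem factorizing_lyndon : factorizing lyndonb lexge.
Proof.
apply: factorizing_of_last lyndonb_nil lynfact_exists _ => w s x t y wsx wty.
have [[/and3P[Lx _ /eqP wx]] [/and3P[Ly _ /eqP wy]]] := (wsx, wty).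
move: Lx Ly wx wy; rewrite !all_rcons !flatten_rcons.
move=> /andP[Lx _] /andP[Ly _] wx wy.
apply: lexle_anti; rewrite (last_factor_min wsx (esym wy)).
  by rewrite (last_factor_min wty (esym wx)) //; case/lyndonbP: Lx.
by case/lyndonbP: Ly.
Qed.

End Lyndon.

Theorem mainTheorem4 (d : Order.disp_t) (A : finOrderType d) (n : nat)
    (hA : 2 <= #|A|) (hn : 1 <= n) :
  #|[set w : n.-tuple A | `[< nyldon w >]]| =
  #|[set w : n.-tuple A | `[< lyndon w >]]|.
Proof.
have ge_tr : transitive (@lexge d A) by move=> v u w uv vw; apply: lexle_trans vw uv.
have ge_anti : antisymmetric (@lexge d A) by move=> u v /lexle_anti.
have ge_tot : total (@lexge d A) by move=> u v; apply: lexle_total.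
have := factorizing_count n lexle_total lexle_trans lexle_anti ge_tot ge_tr
  ge_anti factorizing_nyldon factorizing_lyndon.
by rewrite !size_words !cardsE.
Qed.
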